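(* Let $p$ be the mesh pattern $(12,R)$ with $R=\{(0,0),(0,1),(0,2),(1,0),(2,0)\}$, let $E(t,u)=\sum_{n\ge0}t^n\sum_{\sigma\in K_n}u^{p(\sigma)}$, and let $P(t)=\sum_{n\ge0}|K_n(p)|t^n$. Then $$P(t)=t+\frac{A(t)}{1+t},\qquad E(t,u)=\frac{A(t)}{1+t}+\frac{tA(ut)}{1+ut}.$$ The initial terms of $E(t,u)$ are $1+t+2t^4+(12+2u^4)t^5+(78+12u^5)t^6+(568+78u^6)t^7+(4674+568u^7)t^8+\cdots$.
   Context: A permutation $\sigma=\sigma_1\cdots\sigma_n$ of $\{1,\dots,n\}$ is a king permutation if $|\sigma_{i+1}-\sigma_i|>1$ for all $1\le i\le n-1$. $K_n$ is the set of king permutations of length $n$ ($K_0$ = the empty permutation, $K_1=\{1\}$) and $A(t)=\sum_{n\ge0}|K_n|t^n$ (known to equal $\sum_{n\ge0}n!\,t^n(1-t)^n/(1+t)^n$). For a mesh pattern $p=(12,R)$ with $R\subseteq\{0,1,2\}^2$, an occurrence of $p$ in $\sigma\in S_n$ is a pair of positions $i_1<i_2$ with $\sigma_{i_1}<\sigma_{i_2}$ such that for every $(x,y)\in R$ there is no position $m$ with $i_x<m<i_{x+1}$ and $v_y<\sigma_m<v_{y+1}$, where $i_0=0$, $i_3=n+1$, $v_0=0$, $v_1=\sigma_{i_1}$, $v_2=\sigma_{i_2}$, $v_3=n+1$ (first coordinate of a box indexes positions, second values). $p(\sigma)$ is the number of occurrences of $p$ in $\sigma$; $K_n(p)$ is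 the set of king $n$-permutations with $p(\sigma)=0$. *)

(* Defs.v *)
From HB Require Import structures.
From mathcomp Require Export all_boot all_order all_algebra perm.

Set Implicit Arguments.
Unset Strict Implicit.
Unset Printing Implicit Defensive.

Import GRing.Theory.
Local Open Scope ring_scope.

(* A formal power series is its sequence of coefficients; series are compared
   coefficientwise with =1. *)
Definition fps (R : Type) : Type := nat -> R.

Declare Scope fps_scope.
Delimit Scope fps_scope with fps.
Bind Scope fps_scope with fps.

Section FormalPowerSeries.
Variable R : comUnitRingType.
Implicit Types f g : fps R.

Definition fps_const (c : R) : fps R := fun n => if n is 0%N then c else 0.

Definition fps_var : fps R := fun n => (n == 1%N)%:R.

Definition fps_add f g : fps R := fun n => f n + g n.

Definition fps_mul f g : fps R := fun n => \sum_(i < n.+1) f i * g (n - i)%N.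

(* First n coefficients of 1 / f, obtained by solving f * (1 / f) = 1
   degree by degree. *)
Fixpoint fps_inv_seq f (n : nat) : seq R :=
  if n is m.+1 then
    let s := fps_inv_seq f m in
    rcons s ((f 0%N)^-1 * ((m == 0%N)%:R - \sum_(i < m) s`_i * f (m - i)%N))
  else [::].

(* The inverse series; meaningful when f 0 is a unit, see fps_divK. *)
Definition fps_inv f : fps R := fun n => (fps_inv_seq f n.+1)`_n.

Definition fps_div f g : fps R := fps_mul f (fps_inv g).

(* The substitution t := u t, i.e., f(u t). *)
Definition fps_dilate (u : R) f : fps R := fun n => u ^+ n * f n.

End FormalPowerSeries.

Arguments fps_var {R}.

Notation "1" := (fps_const 1%R) : fps_scope.
Notation "''t'" := fps_var (at level 0) : fps_scope.
Infix "+" := fps_add : fps_scope.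
Infix "*" := fps_mul : fps_scope.
Infix "/" := fps_div : fps_scope.

Section FpsTheory.
Variable R : comUnitRingType.
Implicit Types f g h : fps R.

Lemma size_fps_inv_seq f n : size (fps_inv_seq f n) = n.
Proof. by elim: n => //= n IHn; rewrite size_rcons IHn. Qed.

Lemma nth_fps_inv_seq f n i : (i < n)%N -> (fps_inv_seq f n)`_i = fps_inv f i.
Proof.
elim: n => // n IHn; rewrite ltnS leq_eqVlt => /predU1P[->//|lt_in].
by rewrite /= nth_rcons size_fps_inv_seq lt_in IHn.
Qed.

Lemma fps_invE f n :
  fps_inv f n =
    (f 0%N)^-1 * ((n == 0%N)%:R - \sum_(i < n) fps_inv f i * f (n - i)%N).
Proof.
rewrite {1}/fps_inv /= nth_rcons size_fps_inv_seq ltnn eqxx.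
by under eq_bigr => i _ do rewrite nth_fps_inv_seq ?ltn_ord //.
Qed.

Lemma fps_mulVr f : f 0%N \is a GRing.unit -> (fps_inv f * f =1 1)%fps.
Proof.
move=> uf n; rewrite /fps_mul big_ord_recr /= subnn [fps_inv f n]fps_invE.
by rewrite mulrAC mulVr // mul1r addrC subrK; case: n.
Qed.

Lemma fps_mulA f g h : (f * (g * h) =1 f * g * h)%fps.
Proof.
move=> n; rewrite /fps_mul.
under eq_bigr => i _ do rewrite big_distrr /=.
under [RHS]eq_bigr => i _ do rewrite big_distrl /=.
pose F i j := f i * g j * h (n - i - j)%N.
transitivity (\sum_(i < n.+1) \sum_(j < n.+1 | (i + j <= n)%N) F i j).
  apply: eq_bigr => i _; have le_in: (i <= n)%N by rewrite -ltnS.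
  rewrite (big_ord_widen n.+1 (fun j => f i * (g j * h (n - i - j)%N))).
    apply: eq_big => [j|j _]; last by rewrite /F mulrA.
    by rewrite ltnS -(leq_add2l i) subnKC.
  by rewrite ltnS leq_subr.
transitivity (\sum_(k < n.+1) \sum_(i < n.+1 | (i <= k)%N) F i (k - i)%N);
  last first.
  apply: eq_bigr => k _.
  rewrite (big_ord_widen n.+1 (fun i => f i * g (k - i)%N * h (n - k)%N)) //.
  apply: eq_bigr => i le_ik.
  by rewrite /F -subnDA subnKC.
rewrite [RHS](exchange_big_dep predT) //=; apply: eq_bigr => i _.
have le_in: (i <= n)%N by rewrite -ltnS.
rewrite (reindex_onto (fun k : 'I_n.+1 => inord (k - i) : 'I_n.+1)
                      (fun j : 'I_n.+1 => inord (i + j))) /=; last first.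
  by move=> j le_ijn; rewrite inordK // addKn inord_val.
apply: eq_big => [k|k].
  have le_kn: (k <= n)%N by rewrite -ltnS.
  have lt_ki: (k - i < n.+1)%N by rewrite ltnS (leq_trans (leq_subr _ _)).
  rewrite inordK //; case: (leqP i k) => [le_ik|lt_k_i].
    by rewrite subnKC // le_kn -[X in _ == X]inord_val eqxx.
  have /eqP-> : (k - i == 0)%N by rewrite subn_eq0 ltnW.
  rewrite addn0 le_in /=; apply/negbTE/eqP => /(congr1 val) /=.
  by rewrite inordK ?ltnS // => eik; rewrite -eik ltnn in lt_k_i.
move=> _; rewrite inordK // ltnS (leq_trans (leq_subr _ _)) //.
by rewrite -ltnS.
Qed.

Lemma fps_mulr1 f : (f * 1 =1 f)%fps.
Proof.
move=> n; rewrite /fps_mul big_ord_recr /= subnn mulr1 big1 ?add0r // => i _.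
by rewrite /fps_const; case: (n - i)%N (subn_gt0 i n) => [|k];
   rewrite ?ltn_ord ?mulr0.
Qed.

Lemma fps_divK f g : g 0%N \is a GRing.unit -> (f / g * g =1 f)%fps.
Proof.
move=> ug n; rewrite -(fps_mulA f (fps_inv g) g n) -[RHS]fps_mulr1.
by apply: eq_bigr => i _; rewrite fps_mulVr.
Qed.

End FpsTheory.

(* A permutation s : 'S_n acts on {0, ..., n - 1}: position i + 1 of the word
   carries the value s i + 1. *)
Section KingPermutations.
Variable n : nat.
Implicit Type s : 'S_n.

Definition is_king s : bool :=
  [forall i : 'I_n, forall j : 'I_n,
    (j == i.+1 :> nat) ==> (1 < `|(s j)%:Z - (s i)%:Z|)].

Definition king : {set 'S_n} := [set s | is_king s].

Implicit Type R : {set 'I_3 * 'I_3}.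

(* The values i_0, i_1, i_2, i_3 and v_0, v_1, v_2, v_3 delimiting the
   columns and the rows of the mesh, in 1-based numbering. *)
Definition mesh_pos (i1 i2 : 'I_n) (x : nat) : nat :=
  nth 0%N [:: 0%N; i1.+1; i2.+1; n.+1] x.

Definition mesh_val s (i1 i2 : 'I_n) (y : nat) : nat :=
  nth 0%N [:: 0%N; (s i1).+1; (s i2).+1; n.+1] y.

Definition in_box s (i1 i2 : 'I_n) (b : 'I_3 * 'I_3) (m : 'I_n) : bool :=
  (mesh_pos i1 i2 b.1 < m.+1 < mesh_pos i1 i2 b.1.+1)%N
  && (mesh_val s i1 i2 b.2 < (s m).+1 < mesh_val s i1 i2 b.2.+1)%N.

Definition mesh12_occ R s (i : 'I_n * 'I_n) : bool :=
  [&& (i.1 < i.2)%N, (s i.1 < s i.2)%N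
    & [forall b in R, ~~ [exists m, in_box s i.1 i.2 b m]]].

Definition mesh12_count R s : nat := #|[set i | mesh12_occ R s i]|.

Definition king_avoid R : {set 'S_n} :=
  [set s in king | mesh12_count R s == 0%N].

End KingPermutations.

Definition king_gf (R : comUnitRingType) : fps R := fun n => #|king n|%:R.

Definition avoid_gf (Rm : {set 'I_3 * 'I_3}) : fps int :=
  fun n => #|king_avoid n Rm|%:R.

(* E(t, u) is a power series in t with coefficients in Z[u]; the variable u is
   'X : {poly int}. *)
Definition distr_gf (Rm : {set 'I_3 * 'I_3}) : fps {poly int} :=
  fun n => \sum_(s in king n) 'X ^+ mesh12_count Rm s.

Definition corner_mesh : {set 'I_3 * 'I_3} :=
  [set b : 'I_3 * 'I_3 | (val b.1, val b.2) \in
     [:: (0, 0); (0, 1); (0, 2); (1, 0); (2, 0)]%N].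

(* Main.v *)
(* The shaded boxes of column 0 and row 0 force an occurrence to start at the
   leftmost point, which must carry the least value, and leave its second point
   free. Hence p(s) = n - 1 if the word of s starts with its least value, and
   p(s) = 0 otherwise. Deleting that leading value is a bijection from the king
   permutations of length n + 1 that start with their least value onto the king
   permutations of length n that do not. So if c_n counts the latter, then
   |K_(n+1)| = c_(n+1) + c_n, that is, the c_n have generating function
   A(t) / (1 + t). *)
Require Import Defs.
From mathcomp Require Import zify.

Set Implicit Arguments.
Unset Strict Implicit.
Unset Printing Implicit Defensive.

Import GRing.Theory.
Local Open Scope ring_scope.

(** * Quotients of formal power series *)

(** By strong induction: in degree n the two products differ only in the term with the unit [g 0],
    as the lower coefficients already agree. *)
Lemma fps_mul_cancelr (R : comUnitRingType) (f h g : fps R) :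
  g 0%N \is a GRing.unit -> (f * g =1 h * g)%fps -> f =1 h.
Proof.
move=> ug fg n; elim/ltn_ind: n => n IHn.
have := fg n; rewrite /fps_mul !big_ord_recr /= subnn.
under eq_bigr => i _ do rewrite IHn //.
by move/addrI/(mulIr ug).
Qed.

Lemma fps_div_unique (R : comUnitRingType) (f g h : fps R) :
  g 0%N \is a GRing.unit -> (h * g =1 f)%fps -> (h =1 f / g)%fps.
Proof.
move=> ug hg; apply: (@fps_mul_cancelr _ _ _ g) => // n.
by rewrite fps_divK // hg.
Qed.

(** Serves for both denominators, $1+t$ and $1+ut$. *)
Lemma fps_mul_linear (R : comUnitRingType) (a : R) (f g : fps R) n :
  g 0%N = 1 -> g 1%N = a -> (forall k, g k.+2 = 0) ->
  (f * g)%fps n = f n + (if n is m.+1 then a * f m else 0).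
Proof.
move=> g0 g1 g2; rewrite /fps_mul; case: n => [|n].
  by rewrite big_ord1 g0 mulr1 addr0.
rewrite !big_ord_recr /= subnn subSnn g0 g1 mulr1 [a * _]mulrC addrC.
rewrite big1 ?add0r // => i _.
have -> : (n.+1 - i = (n - i.+1).+2)%N by have := ltn_ord i; lia.
by rewrite g2 mulr0.
Qed.

Lemma fps_mulX (R : comUnitRingType) (f : fps R) n :
  ('t * f)%fps n = if n is m.+1 then f m else 0.
Proof.
rewrite /fps_mul /fps_var; case: n => [|n].
  by rewrite big_ord1 mul0r.
rewrite 2!big_ord_recl /= mul0r add0r mul1r subn1 big1 ?addr0 // => i _.
by rewrite mul0r.
Qed.

(** * Permutations as words *)

Definition far : rel nat := fun a b => (a.+1 < b)%N || (b.+1 < a)%N.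

Definition word n (s : 'S_n) : seq nat := [seq val (s i) | i <- enum 'I_n].

Lemma size_word n (s : 'S_n) : size (word s) = n.
Proof. by rewrite size_map size_enum_ord. Qed.

Lemma nth_word n (s : 'S_n) x (i : 'I_n) : nth x (word s) i = s i.
Proof. by rewrite (nth_map i) ?size_enum_ord // nth_ord_enum. Qed.

Lemma word_inj n : injective (@word n).
Proof.
move=> s1 s2 e; apply/permP => i; apply: val_inj.
by rewrite /= -(nth_word s1 0%N) e nth_word.
Qed.

Lemma perm_word n (s : 'S_n) : perm_eq (word s) (iota 0 n).
Proof.
rewrite -val_enum_ord /word map_comp; apply: perm_map.
apply: uniq_perm; rewrite ?(map_inj_uniq perm_inj) ?enum_uniq // => i.
by rewrite mem_enum -[i](permKV s) map_f // mem_enum.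
Qed.

(** Distinct permutations have distinct words, and both lists have $n!$ entries, so one inclusion
    suffices. *)
Lemma perm_words n :
  perm_eq [seq word s | s <- enum {: 'S_n}] (permutations (iota 0 n)).
Proof.
have Uw : uniq [seq word s | s <- enum {: 'S_n}].
  by rewrite (map_inj_uniq (@word_inj n)) enum_uniq.
apply: uniq_perm; rewrite ?permutations_uniq //.
apply: (uniq_min_size Uw _ _).2.
  by move=> _ /mapP[s _ ->]; rewrite mem_permutations perm_word.
by rewrite size_permutations ?iota_uniq // size_iota size_map -cardE card_Sn.
Qed.

Lemma card_word n (P : pred (seq nat)) :
  #|[set s : 'S_n | P (word s)]| = count P (permutations (iota 0 n)).
Proof.
rewrite -(seq.permP (perm_words n)) count_map enumT cardsE cardE.
exact: size_filter.
Qed.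

Lemma is_king_word n (s : 'S_n) : is_king s = sorted far (word s).
Proof.
apply/forallP/(sortedP 0%N) => [ks i|ks i].
  rewrite size_word => lt_i1n; have lt_in := ltnW lt_i1n.
  rewrite (nth_word s _ (Ordinal lt_in)) (nth_word s _ (Ordinal lt_i1n)).
  have /forallP/(_ (Ordinal lt_i1n))/implyP := ks (Ordinal lt_in).
  move=> /(_ (eqxx _)); rewrite /far; lia.
apply/forallP => j; apply/implyP => /eqP eji.
have := ks i; rewrite -eji size_word ltn_ord => /(_ isT).
rewrite !nth_word /far; lia.
Qed.

Lemma king_word n : king n = [set s | sorted far (word s)].
Proof. by apply/setP => s; rewrite !inE is_king_word. Qed.

(** * King permutations by first letter, and their small counts *)

Definition starts0 (w : seq nat) : bool :=
  if w is x :: _ then x == 0%N else false.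

Definition king_first0 n : nat :=
  count (fun w => sorted far w && starts0 w) (permutations (iota 0 n)).

(** This is $c_n$. The empty word does not start with 0, so $c_0=1$, which accounts for the king
    permutation of length 1. *)
Definition king_other n : nat :=
  count (fun w => sorted far w && ~~ starts0 w) (permutations (iota 0 n)).

Lemma card_king n : #|king n| = (king_first0 n + king_other n)%N.
Proof.
rewrite king_word card_word /king_first0 /king_other.
rewrite -!size_filter -(count_predC starts0) -!size_filter -!filter_predI.
congr (_ + _)%N; congr size; apply: eq_filter => w; exact: andbC.
Qed.

Lemma count_permutations_cons (T : eqType) (P : pred (seq T)) s :
  uniq s -> s != [::] ->
  count P (permutations s) =
  sumn [seq count (fun w => P (x :: w)) (permutations (rem x s)) | x <- s].
Proof.
move=> Us ns; have s_gt0 : (0 < size s)%N by rewrite lt0n size_eq0.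
rewrite (seq.permP (permutationsE s_gt0)) undup_id // count_flatten -map_comp.
by congr sumn; apply: eq_map => x /=; rewrite count_map.
Qed.

Lemma king_first0S n :
  king_first0 n.+1 = count (path far 0%N) (permutations (iota 1 n)).
Proof.
rewrite /king_first0 count_permutations_cons ?iota_uniq //=.
rewrite -[RHS]addn0; congr (_ + _)%N.
  by apply: eq_count => w; rewrite andbT.
rewrite sumnE big_map big1_seq // => x /=; rewrite mem_iota => /andP[x0 _].
rewrite -[RHS](count_pred0 (permutations (rem x (iota 0 n.+1)))).
by apply: eq_count => w /=; rewrite eqn0Ngt x0 andbF.
Qed.

Lemma perm_permutations_map (T1 T2 : eqType) (f : T1 -> T2) s :
  injective f -> uniq s ->
  perm_eq [seq map f w | w <- permutations s] (permutations (map f s)).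
Proof.
move=> f_inj Us.
have Um : uniq [seq map f w | w <- permutations s].
  by rewrite map_inj_uniq ?permutations_uniq //; apply: inj_map.
apply: uniq_perm; rewrite ?permutations_uniq //.
apply: (uniq_min_size Um _ _).2.
  by move=> _ /mapP[w + ->]; rewrite !mem_permutations; apply: perm_map.
by rewrite size_map !size_permutations ?map_inj_uniq // size_map.
Qed.

(** The relation [far] is invariant under a common shift, and 0 is far from $x+1$ exactly when $x$
    is nonzero. *)
Lemma path_far0_succ w :
  path far 0%N (map succn w) = sorted far w && ~~ starts0 w.
Proof.
case: w => //= x w; rewrite path_map andbC; congr (_ && _).
by case: x.
Qed.

Lemma king_first0_other n : king_first0 n.+1 = king_other n.
Proof.
rewrite king_first0S -[iota 1 n]/(iota (1 + 0) n) iotaDl.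
rewrite -(seq.permP (perm_permutations_map _ (iota_uniq _ _))); last exact: succn_inj.
by rewrite count_map; apply: eq_count => w /=; rewrite -path_far0_succ.
Qed.

(* For size s = k this is a backtracking search, so it evaluates quickly where
   enumerating permutations s or 'S_n would not. *)
Fixpoint count_far_paths (k : nat) (a : nat) (s : seq nat) : nat :=
  if k is k'.+1 then
    sumn [seq if far a x then count_far_paths k' x (rem x s) else 0%N | x <- s]
  else 1%N.

Lemma count_far_pathsE k a s : uniq s -> size s = k ->
  count (path far a) (permutations s) = count_far_paths k a s.
Proof.
elim: k a s => [|k IHk] a s Us sz_s; first by case: s sz_s Us.
rewrite count_permutations_cons //; last by case: s sz_s {Us}.
rewrite /=; congr sumn; apply/eq_in_map => x sx.
case: ifP => _; first by rewrite -IHk ?rem_uniq ?size_rem ?sz_s.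
exact: count_pred0.
Qed.

Lemma king_other_small n : (n < 9)%N ->
  king_other n = nth 0%N [:: 1; 0; 0; 0; 2; 12; 78; 568; 4674]%N n.
Proof.
(* Putting a 0 back in front turns $c_n$ into a count of far paths from 0 through $1,\dots,n$, which
   the search evaluates. *)
move=> n9; transitivity (count_far_paths n 0 (iota 1 n)).
  rewrite -king_first0_other king_first0S.
  by apply: count_far_pathsE; rewrite ?iota_uniq ?size_iota.
apply/eqP; move: n n9.
have: all (fun n => count_far_paths n 0 (iota 1 n) ==
    nth 0%N [:: 1; 0; 0; 0; 2; 12; 78; 568; 4674]%N n) (iota 0 9).
  by vm_compute.
by move=> /allP all9 n n9; apply: all9; rewrite mem_iota.
Qed.

(** * Occurrences of the corner pattern *)

Lemma corner_occE n (s : 'S_n.+1) i :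
  mesh12_occ corner_mesh s i = [&& i.1 == ord0, s ord0 == ord0 & i.2 != ord0].
Proof.
case: i => i1 i2; rewrite /mesh12_occ /=; apply/and3P/and3P => [[lt_i lt_s occ]|].
  have Nbox (x y : 'I_3) m :
      (val x, val y) \in [:: (0, 0); (0, 1); (0, 2); (1, 0); (2, 0)]%N ->
      ~~ in_box s i1 i2 (x, y) m.
    move=> xyR; have /forallP/(_ (x, y))/implyP := occ.
    by rewrite inE => /(_ xyR); rewrite negb_exists => /forallP.
  (* Otherwise position 0 lies in column 0, and its value differs from those at [i1] and [i2], so it
     falls in one of the three boxes of that column. *)
  have i10 : i1 = ord0.
    apply/eqP; apply: contraT => i1n0.
    have i1gt0 : (0 < i1)%N by rewrite lt0n.
    have s0i1 : s ord0 != s i1 by rewrite (inj_eq perm_inj) eq_sym.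
    have s0i2 : s ord0 != s i2.
      by rewrite (inj_eq perm_inj) eq_sym -lt0n (leq_trans _ lt_i).
    have := Nbox ord0 ord0 ord0 isT.
    have := Nbox ord0 (inord 1) ord0.
    have := Nbox ord0 (inord 2) ord0.
    rewrite /in_box /= !inordK //= => /(_ isT) + /(_ isT).
    rewrite /mesh_pos /mesh_val /=.
    move: s0i1 s0i2; rewrite -!val_eqE /=; have := ltn_ord (s ord0); lia.
  subst i1; split=> //; last by rewrite -lt0n.
  (* Otherwise the point of value 0 lies in row 0, to the right of [i1] and off [i2], hence in box
     (1,0) or (2,0). *)
  apply: contraT => s0n0.
  have [m sm] : exists m, s m = ord0 by exists (s^-1%g ord0); rewrite permKV.
  have mn0 : m != ord0 by apply: contraNneq s0n0 => m0; rewrite -{1}m0 sm.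
  have mi2 : m != i2 by apply: contraTneq lt_s => m2; rewrite -m2 sm.
  have := Nbox (inord 1) ord0 m.
  have := Nbox (inord 2) ord0 m.
  rewrite /in_box /= !inordK //= => /(_ isT) + /(_ isT).
  rewrite /mesh_pos /mesh_val /= sm /=.
  move: mn0 mi2 s0n0; rewrite -!val_eqE /=; have := ltn_ord m; lia.
case=> /eqP-> /eqP s0 i2n0; split; rewrite ?lt0n // ?s0.
  by rewrite /= lt0n -[_ == _]/(s i2 == ord0) -s0 (inj_eq perm_inj).
(* Every shaded box is in column 0 or row 0, and both are now empty: they ask for an integer
   strictly between 0 and 1. *)
apply/forallP => -[x y]; apply/implyP; rewrite inE /= => xyR.
rewrite negb_exists; apply/forallP => m; rewrite /in_box /mesh_pos /mesh_val /= s0.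
move: xyR; rewrite !inE !xpair_eqE.
by do 4!(case/orP; first by case/andP=> /eqP-> /eqP->; rewrite /=; lia);
  case/andP=> /eqP-> /eqP->; rewrite /=; lia.
Qed.

Lemma starts0_word n (s : 'S_n.+1) : starts0 (word s) = (s ord0 == ord0).
Proof. by rewrite -val_eqE /= -(nth_word s 1%N) /= /word enum_ordSl. Qed.

Lemma corner_count n (s : 'S_n) :
  mesh12_count corner_mesh s = if starts0 (word s) then n.-1 else 0%N.
Proof.
case: n s => [|n] s.
  rewrite (_ : word s = [::]); last by apply: size0nil; rewrite size_word.
  by apply: eq_card0 => -[[]].
rewrite starts0_word; case: ifPn => s0.
  rewrite /mesh12_count (_ : [set _ | _] = setX [set ord0] [set~ ord0]).
    by rewrite cardsX cards1 cardsC1 card_ord mul1n.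
  by apply/setP => i; rewrite !inE corner_occE s0.
by apply: eq_card0 => i; rewrite !inE corner_occE (negPf s0) andbF.
Qed.

(** * Generating functions *)

Lemma card_king_first0 n :
  #|[set s in king n | starts0 (word s)]| = king_first0 n.
Proof.
rewrite -[RHS]card_word king_word; congr #|pred_of_set _|.
by apply/setP => s; rewrite !inE.
Qed.

Lemma card_king_other n :
  #|[set s in king n | ~~ starts0 (word s)]| = king_other n.
Proof.
rewrite -[RHS]card_word king_word; congr #|pred_of_set _|.
by apply/setP => s; rewrite !inE.
Qed.

Lemma distr_gf_corner n :
  distr_gf corner_mesh n = (king_other n)%:R + (king_first0 n)%:R * 'X^(n.-1).
Proof.
rewrite /distr_gf (bigID (fun s => starts0 (word s))) /= addrC.
under eq_bigr => s /andP[_ Ns] do rewrite corner_count (negPf Ns) expr0.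
under [X in _ + X]eq_bigr => s /andP[_ Ss] do rewrite corner_count Ss.
rewrite !sumr_const mulr_natl -card_king_first0 -card_king_other.
by rewrite !cardsE.
Qed.

(** A word starting with 0 has $n-1$ occurrences, which vanishes only for $n=1$; that single
    permutation gives the extra $t$. *)
Lemma avoid_gf_corner n :
  avoid_gf corner_mesh n = (n == 1%N)%:R + (king_other n)%:R.
Proof.
rewrite /avoid_gf -natrD -card_king_other; congr _%:R.
have [->|n1] := eqVneq n 1%N.
  rewrite card_king_other.
  have -> : king_avoid 1 corner_mesh = [set: 'S_1].
    apply/setP=> s; rewrite !inE corner_count is_king_word if_same eqxx andbT.
    by case: (word s) (size_word s) => [|x []].
  by rewrite cardsT card_Sn king_other_small.
congr #|pred_of_set _|; apply/setP=> s; rewrite !inE corner_count.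
congr (_ && _); case: ifP => // S0; case: n s n1 S0 => [|[|n]] s //= _.
by rewrite (size0nil (size_word s)).
Qed.

Lemma king_gf_recurrence (R : comUnitRingType) n :
  king_gf R n = (king_other n)%:R + (if n is m.+1 then (king_other m)%:R else 0).
Proof.
rewrite /king_gf card_king natrD addrC; case: n => [|n] //.
by rewrite king_first0_other.
Qed.

Lemma king_gf_div (R : comUnitRingType) :
  (fun n => (king_other n)%:R : R) =1 (king_gf R / (1 + 't))%fps.
Proof.
apply: fps_div_unique => [|n]; first by rewrite /fps_add addr0 unitr1.
rewrite (fps_mul_linear (a := 1)) /fps_add /fps_var ?addr0 ?add0r //.
  by rewrite king_gf_recurrence; case: n => // n; rewrite mul1r.
by move=> k; rewrite addr0.
Qed.

Lemma king_gf_dilate_div (R : comUnitRingType) (u : R) n :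
  ('t * fps_dilate u (king_gf R) / (1 + fps_const u * 't))%fps n =
  if n is m.+1 then u ^+ m * (king_other m)%:R else 0.
Proof.
(* With $C$ the series of the $c_n$, [D] is $C(ut)$, and $A=(1+t)C$ becomes $A(ut)=(1+ut)C(ut)$. *)
pose D : fps R := fun m => u ^+ m * (king_other m)%:R.
transitivity (('t * D)%fps n); last exact: fps_mulX.
have g0 : (1 + fps_const u * 't)%fps 0%N = 1.
  by rewrite /fps_add /fps_mul big_ord1 mulr0 addr0.
symmetry; move: n; apply: fps_div_unique => [|n]; first by rewrite g0 unitr1.
rewrite -fps_mulA !fps_mulX; case: n => // n.
rewrite (fps_mul_linear (a := u)) //=.
- rewrite /fps_dilate king_gf_recurrence mulrDr; congr (_ + _).
  by case: n => [|n]; rewrite ?mulr0 // mulrA -exprS.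
- by rewrite /fps_add /fps_mul !big_ord_recl big_ord0 /= mulr1 mul0r !addr0 add0r.
move=> k; rewrite /fps_add /fps_mul big_ord_recl /= mulr0 !add0r.
by rewrite big1 // => i _; rewrite mul0r.
Qed.

Theorem theorem3p3 :
  let P : fps int := avoid_gf corner_mesh in
  let E : fps {poly int} := distr_gf corner_mesh in
  let u : {poly int} := 'X in
  [/\ (P =1 't + king_gf int / (1 + 't))%fps,
      (E =1 king_gf {poly int} / (1 + 't)
            + 't * fps_dilate u (king_gf {poly int})
              / (1 + fps_const u * 't))%fps
    & \poly_(n < 9) E n =
        1 + 'X + 2 *: 'X^4 + (12 + 2 * u ^+ 4) *: 'X^5
          + (78 + 12 * u ^+ 5) *: 'X^6 + (568 + 78 * u ^+ 6) *: 'X^7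
          + (4674 + 568 * u ^+ 7) *: 'X^8 :> {poly {poly int}}].
Proof.
move=> P E u; split=> [n|n|].
- by rewrite /P avoid_gf_corner /fps_add -king_gf_div.
- rewrite /E distr_gf_corner /fps_add -king_gf_div king_gf_dilate_div.
  (* No empty word starts with 0; in length $n+1$ those that do number $c_n$ and carry $u^n$. *)
  congr (_ + _); case: n => [|n]; first by rewrite mul0r.
  by rewrite king_first0_other mulrC.
(* For $n\ge1$ the coefficient of $t^n$ is $c_n+c_{n-1}u^{n-1}$, so the values $c_0,\dots,c_8$
   suffice. *)
rewrite poly_def !big_ord_recr big_ord0 /= /E !distr_gf_corner !king_first0_other.
rewrite !king_other_small //= !mul0r !addr0 !scale0r !add0r !addr0.
by rewrite mul1r !scale1r.
Qed.
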